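(* Let $\mathcal{S}^2_n\subset\mathcal{C}^{\binom{n+1}{2}}$ be the variety of symmetric $n\times n$ matrices over $\mathcal{C}$ of rank at most $2$. The positive and really positive tropicalizations of $\mathcal{S}^2_n$ coincide and are equal to the set of symmetric $n\times n$ tropical matrices of Barvinok rank at most $2$: $$\mathrm{trop}_{\mathcal{C}^+}(\mathcal{S}^2_n)=\mathrm{trop}_{\mathcal{R}^+}(\mathcal{S}^2_n)=\{A\in\mathbb{R}^{n\times n}: A=A^\top,\ A \text{ has Barvinok rank at most }2\}.$$
   Context: Let $\mathcal{C}=\mathbb{C}\{\!\{t\}\!\}$ and $\mathcal{R}=\mathbb{R}\{\!\{t\}\!\}$ be the fields of complex and real Puiseux series, with valuation $\mathrm{val}(a)$ = the exponent of the lowest degree term of $a\ne0$. Let $\mathcal{C}^+\subset\mathcal{C}$ and $\mathcal{R}^+\subset\mathcal{R}$ be the subsets of nonzero series whose leading coefficient is a positive real number. For a variety $X\subset\mathcal{C}^N$ define $\mathrm{trop}_{\mathcal{C}^+}(X)=\overline{\{\mathrm{val}(x): x\in X\cap(\mathcal{C}^+)^N\}}$ (positive part) and $\mathrm{trop}_{\mathcal{R}^+}(X)=\overline{\{\mathrm{val}(x): x\in X\cap(\mathcal{R}^+)^N\}}$ (really positive part), subsets of $\mathbb{R}^N$, with coordinatewise valuation and Euclidean closure. Coordinates on symmetric matrices are the entries on and above the diagonal, and the tropicalizations of $\mathcal{S}^2_n$ are viewed as sets of real symmetric $n\times n$ matrices. The tropical semiring is $(\mathbb{R},\oplus,\odot)$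 with $x\oplus y=\min(x,y)$, $x\odot y=x+y$. The (usual, not symmetric) Barvinok rank of a tropical matrix $A\in\mathbb{R}^{n\times n}$ is the smallest integer $r$ such that $A=B\odot C$ (tropical matrix product) with $B\in\mathbb{R}^{n\times r}$, $C\in\mathbb{R}^{r\times n}$; the factorization is not required to be symmetric. *)

(* Defs.v *)
From HB Require Import structures.
From mathcomp Require Import all_boot all_order all_algebra.
From mathcomp Require Import complex.
From mathcomp Require Import all_classical all_reals all_analysis.

Set Implicit Arguments.
Unset Strict Implicit.
Unset Printing Implicit Defensive.

Import Order.TTheory GRing.Theory Num.Theory.
Import numFieldNormedType.Exports.

Local Open Scope classical_set_scope.
Local Open Scope ring_scope.

(** A formal Puiseux series in t is represented by its coefficient function:
    [f q] is the coefficient of t^q. *)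

Section PuiseuxSupport.
Variable K : fieldType.

(* The exponents of f lie in (1/d)Z for some d > 0 and are bounded below. *)
Definition is_puiseux (f : rat -> K) : Prop :=
  exists (d : nat) (m : int), (0 < d)%N /\
    forall q, f q != 0 -> exists2 k : int, m <= k & q = k%:~R / d%:R.

Definition puiseux_pred : {pred rat -> K} := [pred f | `[< is_puiseux f >]].

(* The n-th point m/d, (m+1)/d, ... of the lattice (1/d)Z from m/d upwards. *)
Definition pt (d : nat) (m : int) (n : nat) : rat := (m + n%:Z)%:~R / d%:R.

Definition grid (d : nat) (m : int) (f : rat -> K) :=
  forall q, f q != 0 -> exists n, q = pt d m n.

Lemma is_puiseuxP (f : rat -> K) :
  is_puiseux f <-> exists (d : nat) (m : int), (0 < d)%N /\ grid d m f.
Proof.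
split=> -[d [m [d0 H]]]; exists d, m; split=> // q /H.
  case=> k mk ->; exists `|k - m|%N; rewrite /pt gez0_abs ?subr_ge0 //.
  by rewrite addrCA subrr addr0.
by case=> n ->; exists (m + n%:Z) => //; rewrite lerDl.
Qed.

Lemma pt_inj d m : (0 < d)%N -> injective (pt d m).
Proof.
move=> d0 i j /(congr1 (fun x : rat => x * d%:R)).
have dn0 : (d%:R : rat) != 0 by rewrite pnatr_eq0 -lt0n.
rewrite /pt !divfK // => /eqP; rewrite eqr_int => /eqP.
by move/addrI => -[].
Qed.

Lemma ptD d m1 m2 i j : pt d m1 i + pt d m2 j = pt d (m1 + m2) (i + j).
Proof. by rewrite /pt -mulrDl -intrD PoszD addrACA. Qed.

Lemma grid_shift d m m' f : m' <= m -> grid d m f -> grid d m' f.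
Proof.
move=> mm' H q /H [n ->]; exists (`|m - m'| + n)%N.
by rewrite /pt PoszD gez0_abs ?subr_ge0 // addrA (addrC m') subrK.
Qed.

Lemma grid_mul d e m f : (0 < e)%N -> grid d m f ->
  grid (d * e) (m * e%:Z) f.
Proof.
move=> e0 H q /H [n ->]; exists (n * e)%N.
have en0 : (e%:R : rat) != 0 by rewrite pnatr_eq0 -lt0n.
rewrite /pt PoszM -mulrDl natrM intrM -pmulrn invfM mulrACA.
by rewrite divff // mulr1.
Qed.

Lemma common3 (f g h : rat -> K) :
  is_puiseux f -> is_puiseux g -> is_puiseux h ->
  exists d m1 m2 m3, [/\ (0 < d)%N, grid d m1 f, grid d m2 g & grid d m3 h].
Proof.
move=> /is_puiseuxP[d1 [m1 [h1 H1]]] /is_puiseuxP[d2 [m2 [h2 H2]]].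
move=> /is_puiseuxP[d3 [m3 [h3 H3]]].
exists (d1 * d2 * d3)%N, (m1 * (d2 * d3)%N%:Z), (m2 * (d1 * d3)%N%:Z),
  (m3 * (d1 * d2)%N%:Z).
split; first by rewrite !muln_gt0 h1 h2.
- by rewrite -mulnA; apply: grid_mul => //; rewrite muln_gt0 h2.
- by rewrite (mulnC d1) -mulnA; apply: grid_mul => //; rewrite muln_gt0 h1.
- by rewrite mulnC; apply: grid_mul => //; rewrite muln_gt0 h1.
Qed.

Lemma common2 (f g : rat -> K) : is_puiseux f -> is_puiseux g ->
  exists d m1 m2, [/\ (0 < d)%N, grid d m1 f & grid d m2 g].
Proof.
by move=> pf pg; have [d [m1 [m2 [_ [? ? ? _]]]]] := common3 pf pg pg; exists d, m1, m2.
Qed.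

Lemma grid_puiseux d m f : (0 < d)%N -> grid d m f -> is_puiseux f.
Proof. by move=> d0 H; apply/is_puiseuxP; exists d, m. Qed.

Lemma puiseux_zmod_closed : zmod_closed puiseux_pred.
Proof.
split=> [|f g]; rewrite !inE.
  by exists 1%N, 0; split=> // q /eqP[].
move=> pf pg.
have [d [m1 [m2 [d0 gf gg]]]] := common2 pf pg.
apply: (@grid_puiseux d (Num.min m1 m2)) => // q fg.
have [fq|fq] := eqVneq (f q) 0; last first.
  by apply: (grid_shift _ gf) fq; rewrite ge_min lexx.
have gq : g q != 0.
  by apply: contra_neq fg => gq; rewrite [LHS](_ : _ = f q - g q) // fq gq subr0.
by apply: (grid_shift _ gg) gq; rewrite ge_min lexx orbT.
Qed.

HB.instance Definition _ :=
  GRing.isZmodClosed.Build (rat -> K) puiseux_pred puiseux_zmod_closed.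

End PuiseuxSupport.

Record puiseux (K : fieldType) := Puiseux {
  pcoef :> rat -> K;
  pcoefP : pcoef \in @puiseux_pred K }.

HB.instance Definition _ (K : fieldType) := [isSub for @pcoef K].
HB.instance Definition _ (K : fieldType) := [Choice of puiseux K by <:].
HB.instance Definition _ (K : fieldType) :=
  [SubChoice_isSubZmodule of puiseux K by <:].

Section PuiseuxField.
Variable K : fieldType.
Implicit Types (u v w : rat -> K) (f g h : puiseux K).

Lemma puiseuxP f : is_puiseux f.
Proof. by have /[!inE] := pcoefP f. Qed.

Lemma puiseux_eq f g : f =1 g -> f = g.
Proof. by move=> fg; apply: val_inj; apply/funext. Qed.

Lemma pcoefD f g q : (f + g) q = f q + g q. Proof. by []. Qed.
Lemma pcoefN f q : (- f) q = - f q. Proof. by []. Qed.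
Lemma pcoef0 q : (0 : puiseux K) q = 0. Proof. by []. Qed.

(* Cauchy product; the sum is finite because the supports of u and v are
   bounded below and contained in a common lattice. *)
Definition pmul_fun u v (q : rat) : K :=
  \sum_(a \in [set: rat]) u a * v (q - a).

Lemma fsum_seq (F : rat -> K) (r : seq rat) : uniq r ->
  (forall a, a \notin r -> F a = 0) ->
  \sum_(a \in [set: rat]) F a = \sum_(a <- r) F a.
Proof.
move=> ur H; rewrite [RHS]fsbig_seq //; apply/esym/fsbig_widen => // a [_ /= ar].
by apply: H; apply/negP.
Qed.

Lemma pmul_grid d m1 m2 u v : grid d m1 u -> grid d m2 v ->
  grid d (m1 + m2) (pmul_fun u v).
Proof.
move=> gu gv q; have [[n ->] _|H] := pselect (exists n, q = pt d (m1 + m2) n).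
  by exists n.
rewrite /pmul_fun fsbig1 ?eqxx // => a _.
have [->|/gu[i ai]] := eqVneq (u a) 0; first by rewrite mul0r.
have [->|/gv[j aj]] := eqVneq (v (q - a)) 0; first by rewrite mulr0.
by case: H; exists (i + j)%N; rewrite -ptD -ai -aj [RHS]addrC subrK.
Qed.

Lemma pmul_pt d m1 m2 u v n : (0 < d)%N -> grid d m1 u -> grid d m2 v ->
  pmul_fun u v (pt d (m1 + m2) n) =
  \sum_(i < n.+1) u (pt d m1 i) * v (pt d m2 (n - i)).
Proof.
move=> d0 gu gv; rewrite /pmul_fun.
rewrite (@fsum_seq _ [seq pt d m1 i | i <- iota 0 n.+1]); first last.
- move=> a ar.
  have [->|/gu[i ai]] := eqVneq (u a) 0; first by rewrite mul0r.
  have [->|/gv[j aj]] := eqVneq (v (pt d (m1 + m2) n - a)) 0.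
    by rewrite mulr0.
  case/mapP: ar; exists i => //; rewrite mem_iota add0n /= ltnS.
  suff -> : n = (i + j)%N by rewrite leq_addr.
  by apply: (@pt_inj d (m1 + m2)) => //; rewrite -ptD -ai -aj [RHS]addrC subrK.
- by rewrite map_inj_uniq ?iota_uniq //; exact: pt_inj.
rewrite big_map -[iota 0 n.+1]/(index_iota 0 n.+1) big_mkord.
apply: eq_bigr => i _; congr (_ * v _).
by apply/eqP; rewrite subr_eq ptD subnK ?(addrC m2) // -ltnS.
Qed.

(* Truncations as polynomials, used to transfer the ring axioms. *)
Definition tr d m u n : {poly K} := \poly_(i < n) u (pt d m i).

Lemma pmul_tr d m1 m2 u v n k : (0 < d)%N -> grid d m1 u -> grid d m2 v ->
  (n < k)%N ->
  pmul_fun u v (pt d (m1 + m2) n) = (tr d m1 u k * tr d m2 v k)`_n.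
Proof.
move=> d0 gu gv nk; rewrite pmul_pt // coefM; apply: eq_bigr => i _.
have ik : (i < k)%N by rewrite (leq_trans (ltn_ord i)).
by rewrite !coef_poly ik (leq_ltn_trans (leq_subr _ _) nk).
Qed.

Lemma grid_ext d m u v : grid d m u -> grid d m v ->
  (forall n, u (pt d m n) = v (pt d m n)) -> u =1 v.
Proof.
move=> gu gv H q; have [uq|/gu[n ->//]] := eqVneq (u q) 0.
have [vq|/gv[n ->//]] := eqVneq (v q) 0.
by rewrite uq vq.
Qed.

Lemma pmul_closed f g : pmul_fun f g \in @puiseux_pred K.
Proof.
rewrite inE.
have [d [m1 [m2 [d0 gf gg]]]] := common2 (puiseuxP f) (puiseuxP g).
exact: (grid_puiseux d0 (pmul_grid gf gg)).
Qed.

Definition pmul f g : puiseux K := Puiseux (pmul_closed f g).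

Definition pone_fun (q : rat) : K := (q == 0)%:R.

Lemma pone_grid d : grid d 0 pone_fun.
Proof.
move=> q; rewrite /pone_fun; case: (q =P 0) => [-> _|_ /eqP//].
by exists 0%N; rewrite /pt add0r mul0r.
Qed.

Lemma pone_closed : pone_fun \in @puiseux_pred K.
Proof.
by rewrite inE; exact: (grid_puiseux (ltn0Sn 0) (@pone_grid _)).
Qed.

Definition pone : puiseux K := Puiseux pone_closed.

Lemma pone_pt d n : (0 < d)%N -> pone_fun (pt d 0 n) = (n == 0%N)%:R.
Proof.
move=> d0; rewrite /pone_fun; congr ((_ : bool)%:R).
have e0 : pt d 0 0 = 0 by rewrite /pt add0r mul0r.
by rewrite -[X in _ == X]e0 (inj_eq (@pt_inj d 0 d0)).
Qed.

Lemma pmulC : commutative pmul.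
Proof.
move=> f g; apply: puiseux_eq.
have [d [m1 [m2 [d0 gf gg]]]] := common2 (puiseuxP f) (puiseuxP g).
apply: (@grid_ext d (m1 + m2)); first exact: pmul_grid.
  by rewrite addrC; exact: pmul_grid.
move=> n; rewrite /= (@pmul_tr _ _ _ _ _ _ n.+1) //.
by rewrite [m1 + m2]addrC (@pmul_tr _ _ _ _ _ _ n.+1) // mulrC.
Qed.

Lemma coefM_trunc (p p' r : {poly K}) n :
  (forall i, (i <= n)%N -> p`_i = p'`_i) -> (p * r)`_n = (p' * r)`_n.
Proof. by move=> H; rewrite !coefM; apply: eq_bigr => i _; rewrite H // -ltnS. Qed.

Lemma pmulA : associative pmul.
Proof.
move=> f g h; apply: puiseux_eq.
have [d [m1 [m2 [m3 [d0 gf gg gh]]]]] :=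
  common3 (puiseuxP f) (puiseuxP g) (puiseuxP h).
have gfg := pmul_grid gf gg; have ggh := pmul_grid gg gh.
apply: (@grid_ext d (m1 + (m2 + m3))); first exact: pmul_grid.
  by rewrite addrA; exact: pmul_grid.
move=> n; rewrite /= (@pmul_tr _ _ _ _ _ _ n.+1) // addrA.
rewrite (@pmul_tr _ _ _ _ _ _ n.+1) //.
have E1 i : (i <= n)%N -> (tr d (m2 + m3) (pmul_fun g h) n.+1)`_i =
    (tr d m2 g n.+1 * tr d m3 h n.+1)`_i.
  by move=> ni; rewrite coef_poly ltnS ni; exact: pmul_tr.
have E2 i : (i <= n)%N -> (tr d (m1 + m2) (pmul_fun f g) n.+1)`_i =
    (tr d m1 f n.+1 * tr d m2 g n.+1)`_i.
  by move=> ni; rewrite coef_poly ltnS ni; exact: pmul_tr.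
by rewrite mulrC (coefM_trunc _ E1) (coefM_trunc _ E2) mulrC mulrA.
Qed.

Lemma pmul1 : left_id pone pmul.
Proof.
move=> f; apply: puiseux_eq.
have /is_puiseuxP[d [m [d0 gf]]] := puiseuxP f.
apply: (@grid_ext d m) => //.
  by rewrite -[m]add0r; apply: pmul_grid => //; exact: pone_grid.
move=> n; rewrite /= -[in LHS](add0r m) pmul_pt //; last exact: pone_grid.
rewrite big_ord_recl pone_pt // eqxx mul1r subn0 big1 ?addr0 // => i _.
by rewrite pone_pt // mul0r.
Qed.

Lemma pmulDl : left_distributive pmul +%R.
Proof.
move=> f g h; apply: puiseux_eq => q.
have [d [m1 [m2 [m3 [d0 gf gg gh]]]]] :=
  common3 (puiseuxP f) (puiseuxP g) (puiseuxP h).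
pose m := Num.min m1 m2.
have {}gf : grid d m f by apply: grid_shift gf; rewrite ge_min lexx.
have {}gg : grid d m g by apply: grid_shift gg; rewrite ge_min lexx orbT.
have gfg : grid d m (f + g : puiseux K).
  move=> a; rewrite pcoefD; have [->|/gf//] := eqVneq (f a) 0.
  by rewrite add0r => /gg.
pose k : puiseux K := pmul f h + pmul g h.
have gk : grid d (m + m3) k.
  move=> a; rewrite pcoefD.
  have [->|/(pmul_grid gf gh)//] := eqVneq (pmul f h a) 0.
  by rewrite add0r => /(pmul_grid gg gh).
apply: (grid_ext _ gk); first exact: pmul_grid.
move=> n; rewrite pcoefD /= !pmul_pt // -big_split /=.
by apply: eq_bigr => i _; exact: mulrDl.
Qed.

Lemma pone_neq0 : pone != 0.
Proof.
apply/eqP => H; have : pone 0 = (0 : puiseux K) 0 by rewrite H.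
by move/eqP; rewrite pcoef0 /= /pone_fun eqxx oner_eq0.
Qed.

HB.instance Definition _ := GRing.Zmodule_isComNzRing.Build (puiseux K)
  pmulA pmulC pmul1 pmulDl pone_neq0.

Lemma pcoefM f g q :
  (f * g) q = \sum_(a \in [set: rat]) f a * g (q - a).
Proof. by []. Qed.

Lemma pcoef1 q : (1 : puiseux K) q = (q == 0)%:R. Proof. by []. Qed.

Fixpoint inv_seq (F : nat -> K) (n : nat) : seq K :=
  if n is k.+1 then
    let s := inv_seq F k in
    rcons s ((F 0%N)^-1 *
      ((k == 0%N)%:R - \sum_(i < k) F i.+1 * s`_(k - i.+1)))
  else [::].

Lemma size_inv_seq F n : size (inv_seq F n) = n.
Proof. by elim: n => //= n IH; rewrite size_rcons IH. Qed.

Lemma nth_inv_seq F n k : (k < n)%N ->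
  (inv_seq F n)`_k = (inv_seq F k.+1)`_k.
Proof.
elim: n => // n IH; rewrite ltnS leq_eqVlt => /predU1P[->//|kn].
by rewrite -IH //= nth_rcons size_inv_seq kn.
Qed.

Lemma inv_series (F : nat -> K) : F 0%N != 0 ->
  exists G : nat -> K,
    forall n, \sum_(i < n.+1) F i * G (n - i)%N = (n == 0%N)%:R.
Proof.
move=> F0; exists (fun n => (inv_seq F n.+1)`_n) => n.
rewrite big_ord_recl subn0 /= nth_rcons size_inv_seq ltnn eqxx mulVKf //.
set S := (X in _ - X + _); set T := (X in _ - _ + X).
suff -> : T = S by rewrite subrK.
apply: eq_bigr => i _; rewrite [in RHS]nth_inv_seq //.
by rewrite ltn_subrL /= (leq_ltn_trans _ (ltn_ord i)).
Qed.

Lemma puiseux_inv_ex f : f != 0 -> exists g, f * g = 1.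
Proof.
move=> f0; have /is_puiseuxP[d [m [d0 gf]]] := puiseuxP f.
have ex : exists n, f (pt d m n) != 0.
  apply: contra_neqP f0 => H; apply: puiseux_eq => q; rewrite pcoef0.
  apply/eqP/negPn/negP => fq; have [n qn] := gf _ fq.
  by case: H; exists n; rewrite -qn.
have [k fk kmin] := ex_minnP ex.
have {}gf : grid d (m + k%:Z) f.
  move=> q fq; have [n qn] := gf _ fq; exists (n - k)%N.
  by rewrite /pt -addrA -PoszD subnKC // kmin // -qn.
have [|G HG] := @inv_series (fun n => f (pt d (m + k%:Z) n)).
  by rewrite /pt addr0.
set v := m + k%:Z in gf HG.
pose gfun (q : rat) : K := if pselect (exists n, q = pt d (- v) n) is left e
  then G (projT1 (cid e)) else 0.
have gfunE n : gfun (pt d (- v) n) = G n.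
  rewrite /gfun; case: pselect => [e|[]]; last by exists n.
  by case: (cid e) => i /= /(pt_inj d0) ->.
have gg : grid d (- v) gfun.
  by move=> q; rewrite /gfun; case: pselect => // _ /eqP.
have pg : gfun \in @puiseux_pred K.
  by rewrite inE; exact: grid_puiseux gg.
exists (Puiseux pg); apply: puiseux_eq.
apply: (@grid_ext d 0); last 2 first.
- exact: pone_grid.
- move=> n; rewrite [RHS]pone_pt // -HG -[0 in LHS](subrr v).
  rewrite [LHS]pmul_pt //; apply: eq_bigr => i _.
  by rewrite /= gfunE.
- by rewrite -(subrr v); exact: pmul_grid.
Qed.

Definition pinv f : puiseux K := xget 0 [set g | f * g = 1].

Lemma pmulVf f : f != 0 -> pinv f * f = 1.
Proof.
move=> /puiseux_inv_ex[g fg]; rewrite mulrC.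
exact: (@xgetI _ 0 [set g | f * g = 1] g).
Qed.

Lemma pinv0 : pinv 0 = 0.
Proof.
apply: xgetPN => g /= /eqP; rewrite mul0r eq_sym oner_eq0.
by [].
Qed.

HB.instance Definition _ := GRing.ComNzRing_isField.Build (puiseux K)
  pmulVf pinv0.

(* Set to 0 at f = 0. *)
Definition pval f : rat :=
  xget 0 [set q | f q != 0 /\ forall r, f r != 0 -> q <= r].

Definition plead f : K := f (pval f).

Lemma pvalP f : f != 0 -> f (pval f) != 0 /\ forall r, f r != 0 -> pval f <= r.
Proof.
move=> f0; have /is_puiseuxP[d [m [d0 gf]]] := puiseuxP f.
have ex : exists n, f (pt d m n) != 0.
  apply: contra_neqP f0 => H; apply: puiseux_eq => q; rewrite pcoef0.
  apply/eqP/negPn/negP => fq; have [n qn] := gf _ fq.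
  by case: H; exists n; rewrite -qn.
have [k fk kmin] := ex_minnP ex.
apply: (@xgetPex _ 0 [set q | f q != 0 /\ forall r, f r != 0 -> q <= r]).
exists (pt d m k); split => // r fr; have [n rn] := gf _ fr.
rewrite rn /pt ler_pM2r ?invr_gt0 ?ltr0n // ler_int lerD2l lez_nat.
by apply: kmin; rewrite -rn.
Qed.

End PuiseuxField.

Section MapPuiseux.
Variables (K L : fieldType) (phi : {rmorphism K -> L}).

Lemma map_puiseux_closed (f : puiseux K) : phi \o f \in @puiseux_pred L.
Proof.
rewrite inE; have [d [m [d0 H]]] := puiseuxP f.
by exists d, m; split=> // q; rewrite /= fmorph_eq0 => /H.
Qed.

Definition map_puiseux (f : puiseux K) : puiseux L :=
  Puiseux (map_puiseux_closed f).

End MapPuiseux.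

(* In a numFieldType, and in particular in R[i], [0 < c] means that c is real
   and positive. *)
Definition ppos (K : numFieldType) : set (puiseux K) :=
  [set f | f != 0 /\ 0 < plead f].

Section Tropicalization.
Variables (R : realType) (N : nat).

Definition tval (K : fieldType) (x : 'rV[puiseux K]_N) : 'rV[R]_N :=
  \row_i ratr (pval (x 0 i)).

Definition trop_Cpos (X : set 'rV[puiseux R[i]]_N) : set 'rV[R]_N :=
  closure [set tval x | x in X `&` [set x | forall i, ppos (x 0 i)]].

(* The real points of X are the points over puiseux R whose image under the
   coefficientwise inclusion into puiseux R[i] lies in X. *)
Definition trop_Rpos (X : set 'rV[puiseux R[i]]_N) : set 'rV[R]_N :=
  closure [set tval x | x in
    [set x : 'rV[puiseux R]_N |
       X (map_mx (map_puiseux (real_complex R)) x) /\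
       forall i, ppos (x 0 i)]].

End Tropicalization.

Section SymmetricMatrices.
Variable n : nat.

Definition utri := {ij : 'I_n * 'I_n | (ij.1 <= ij.2)%N}.

Lemma card_utri : #|{: utri}| = 'C(n.+1, 2).
Proof.
rewrite card_sig -sum1_card; under eq_bigl => ij do rewrite inE.
rewrite -(pair_big_dep xpredT (fun i j : 'I_n => (i <= j)%N) (fun _ _ => 1%N)).
rewrite /= (exchange_big_dep xpredT) //= -bin2_sum big_mkord big_ord_recl add0n.
apply: eq_bigr => j _; rewrite sum1_card.
have w_inj : injective (widen_ord (ltn_ord j)).
  by move=> a b /(congr1 val) /= ?; apply: val_inj.
rewrite -[RHS]card_ord -(@fintype.card_image _ _ _ w_inj).
apply: eq_card => i; rewrite [LHS]unfold_in; apply/idP/fintype.imageP => [ij|[k _ ->]].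
  by exists (Ordinal (n := j.+1) (m := i) ij) => //; apply: val_inj.
exact: (ltn_ord k).
Qed.

Definition usort (i j : 'I_n) : 'I_n * 'I_n :=
  if (i <= j)%N then (i, j) else (j, i).

Lemma usortP i j : ((usort i j).1 <= (usort i j).2)%N.
Proof. by rewrite /usort; case: (leqP i j) => //= /ltnW. Qed.

Definition uindex (i j : 'I_n) : 'I_#|{: utri}| :=
  enum_rank (exist _ (usort i j) (usortP i j) : utri).

(* The symmetric matrix with the given entries on and above the diagonal. *)
Definition symmx (T : Type) (x : 'rV[T]_#|{: utri}|) : 'M[T]_n :=
  \matrix_(i, j) x 0 (uindex i j).

Definition sym_rank_le2 (K : fieldType) : set 'rV[K]_#|{: utri}| :=
  [set x | (\rank (symmx x) <= 2)%N].

End SymmetricMatrices.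

(* The variety of symmetric n x n matrices of rank at most 2 over the complex
   Puiseux series. *)
Definition S2 (R : realType) (n : nat) : set 'rV[puiseux R[i]]_#|{: utri n}| :=
  @sym_rank_le2 n (puiseux R[i]).

Arguments S2 : clear implicits.

Section Barvinok.
Variable R : realType.

(* Tropical matrix product. The codomain is extended with the neutral element
   +oo of min, which is only attained when r = 0. *)
Definition trop_mulmx m r p (B : 'M[R]_(m, r)) (C : 'M[R]_(r, p)) :
    'M[\bar R]_(m, p) :=
  \matrix_(i, j) \big[Order.min/+oo%E]_(k < r) (B i k + C k j)%:E.

Definition barvinok_factors n (A : 'M[R]_n) (r : nat) : Prop :=
  exists (B : 'M[R]_(n, r)) (C : 'M[R]_(r, n)),
    map_mx EFin A = trop_mulmx B C.

Lemma barvinok_factors_size n (A : 'M[R]_n) : barvinok_factors A n.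
Proof.
pose M := \sum_(i < n) \sum_(j < n) `|A i j|.
have AM i j : `|A i j| <= M.
  rewrite /M (bigD1 i) //= (bigD1 j) //= -addrA lerDl.
  by rewrite addr_ge0 ?sumr_ge0 // => k _; rewrite sumr_ge0.
exists (\matrix_(i, k) if i == k then 0 else M + M), A.
apply/matrixP => i j; rewrite !mxE; apply/eqP; rewrite eq_le; apply/andP; split.
  apply/bigmin_geP; split => [|k _]; first by rewrite leey.
  rewrite lee_fin mxE; case: eqP => [->|_]; first by rewrite add0r.
  have := AM i j; have := AM k j; rewrite !ler_norml => /andP[h1 _] /andP[_ h2].
  by rewrite -addrA (le_trans h2) // lerDl -lerBlDl sub0r.
apply: (bigmin_inf i) => //.
by rewrite mxE eqxx add0r.
Qed.

Lemma barvinok_ex n (A : 'M[R]_n) : exists r, `[< barvinok_factors A r >].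
Proof. by exists n; apply/asboolP; exact: barvinok_factors_size. Qed.

Definition barvinok_rank n (A : 'M[R]_n) : nat := ex_minn (barvinok_ex A).

End Barvinok.

(* Main.v *)
(* A sum of products of series in C+ has no cancellation of leading terms, so
   the vanishing of a 3x3 minor forces the minima of the valuations over its
   three even and its three odd terms to agree. This is a closed condition, and
   it implies Barvinok rank at most 2: if column 0 is scaled to be 0 and every
   column to have minimum 0, then two columns either have disjoint supports or
   one is a truncation min(b, g) of the other, and three nonzero columns cannot
   have pairwise disjoint supports; hence two columns span all the others.
   Conversely, the columns of a matrix A of Barvinok rank at most 2 lie on the
   tropical segment between two of them, say p and q. For symmetric A, applying
   this to rows and columns gives A = S (.) Q (.) S^T with Q the symmetric
   submatrix of A on {p, q}. Approximating S and Q by rational matrices and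
   lifting their entries to monomials t^s gives a real positive symmetric matrix
   of rank at most 2. *)

Require Import Defs.
From HB Require Import structures.
From mathcomp Require Import all_boot all_order all_algebra.
From mathcomp Require Import complex.
From mathcomp Require Import all_classical all_reals all_analysis.
From mathcomp Require Import ring lra.
Set Implicit Arguments.
Unset Strict Implicit.
Unset Printing Implicit Defensive.
Import Order.TTheory GRing.Theory Num.Theory.
Import numFieldNormedType.Exports.
Local Open Scope classical_set_scope.
Local Open Scope ring_scope.

(** * Puiseux series with positive leading coefficient *)

Definition pos_at (K : numFieldType) (q : rat) (f : puiseux K) :=
  0 < f q /\ forall r, r < q -> f r = 0.

Section PosAt.
Variable K : numFieldType.
Implicit Types f g : puiseux K.

Lemma pos_at_val q f : pos_at q f -> ppos f /\ pval f = q.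
Proof.
move=> [fq f0].
have nz : f != 0 by apply: contraTneq fq => ->; rewrite pcoef0 ltxx.
have [fv vmin] := pvalP nz.
have vq : pval f = q.
  apply/eqP; rewrite eq_le vmin ?gt_eqF //= leNgt.
  by apply: contra_neqN fv => /f0.
by split=> //; split=> //; rewrite /plead vq.
Qed.

Lemma ppos_at f : ppos f -> pos_at (pval f) f.
Proof.
move=> [f0 lf]; split=> // r; apply: contraTeq => fr.
by rewrite -leNgt; have [_] := pvalP f0; apply.
Qed.

Lemma pos_at_inj q r f : pos_at q f -> pos_at r f -> q = r.
Proof. by move=> /pos_at_val[_ <-] /pos_at_val[]. Qed.

(** Positive leading coefficients do not cancel, even when [q = r]. *)
Lemma pos_atD q r f g : pos_at q f -> pos_at r g ->
  pos_at (Num.min q r) (f + g).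
Proof.
move=> [fq f0] [gr g0]; split=> [|s]; last first.
  by rewrite lt_min => /andP[sq sr]; rewrite pcoefD f0 // g0 // addr0.
rewrite pcoefD; case: (ltgtP q r) => [qr|rq|qr].
- by rewrite (g0 q) // addr0.
- by rewrite (f0 r) // add0r.
- by rewrite -qr in gr *; rewrite addr_gt0.
Qed.

(** Only the index [a = q] contributes to the coefficient at [q + r], and no index contributes below
    it. *)
Lemma pos_atM q r f g : pos_at q f -> pos_at r g -> pos_at (q + r) (f * g).
Proof.
move=> [fq f0] [gr g0]; split=> [|s sqr]; rewrite pcoefM.
  rewrite (@fsum_seq _ _ [:: q]) //; last first.
    move=> a; rewrite inE; case: ltgtP => // [aq _|qa _].
      by rewrite f0 // mul0r.
    by rewrite g0 ?mulr0 //; rewrite ltrBlDr; rewrite addrC ltrD2l.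
  by rewrite big_seq1 addrAC subrr add0r mulr_gt0.
rewrite fsbig1 // => a _; have [aq|qa] := ltP a q; first by rewrite f0 ?mul0r.
by rewrite (g0 (s - a)) ?mulr0 // ltrBlDr (lt_le_trans sqr) // addrC lerD2l.
Qed.

(* The coefficients of the monomial t^q. *)
Definition pmon_fun (q r : rat) : K := (r == q)%:R.

Lemma pmon_closed q : pmon_fun q \in @puiseux_pred K.
Proof.
rewrite inE; exists `|denq q|%N, (numq q); split.
  by rewrite absz_gt0 denq_neq0.
move=> r; rewrite /pmon_fun; case: (r =P q) => [->|]; last by rewrite eqxx.
move=> _; exists (numq q) => //.
by rewrite -[in LHS](divq_num_den q) -[denq q in LHS]absz_denq.
Qed.

Definition pmon q : puiseux K := Puiseux (pmon_closed q).

Lemma pos_at_pmon q : pos_at q (pmon q).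
Proof.
split=> [|r rq]; rewrite /= /pmon_fun ?eqxx ?ltr01 //.
by rewrite lt_eqF.
Qed.

End PosAt.

Lemma map_puiseux_pos_at (K L : numFieldType) (phi : {rmorphism K -> L}) :
  {homo phi : x / 0 < x} ->
  forall q (f : puiseux K), pos_at q f -> pos_at q (map_puiseux phi f).
Proof.
move=> phi0 q f [fq f0]; split=> [|r rq] /=; first exact: phi0.
by rewrite f0 ?rmorph0.
Qed.

(** * Tropical matrices with vanishing 3x3 minors *)

Section TropicalRankTwo.
Variable F : realFieldType.
Definition min3 (x y z : F) := Num.min x (Num.min y z).

Lemma min3D (x y z c : F) : min3 (x + c) (y + c) (z + c) = min3 x y z + c.
Proof. by rewrite /min3 !addr_minl. Qed.

Lemma min3P (x y z : F) : [/\ min3 x y z <= x, min3 x y z <= y, min3 x y z <= z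
  & [\/ min3 x y z = x, min3 x y z = y | min3 x y z = z]].
Proof.
rewrite /min3 !ge_min !lexx /= !orbT; split=> //.
case: (leP y z) => _; case: leP => _;
  by [constructor 1|constructor 2|constructor 3].
Qed.

Variables I J : finType.
(* The even and the odd terms of every 3x3 tropical determinant have the same
   minimum. Rows and columns may repeat: such minors satisfy this trivially. *)
Definition minors3_vanish (A : I -> J -> F) := forall i1 i2 i3 j1 j2 j3,
  min3 (A i1 j1 + A i2 j2 + A i3 j3) (A i1 j2 + A i2 j3 + A i3 j1)
       (A i1 j3 + A i2 j1 + A i3 j2) =
  min3 (A i1 j1 + A i2 j3 + A i3 j2) (A i1 j2 + A i2 j1 + A i3 j3)
       (A i1 j3 + A i2 j2 + A i3 j1).

Lemma minors3_vanish_shift (A : I -> J -> F) u v : minors3_vanish A ->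
  minors3_vanish (fun i j => A i j + u i + v j).
Proof.
move=> P i1 i2 i3 j1 j2 j3.
have := P i1 i2 i3 j1 j2 j3.
move/(congr1 (fun x => x + (u i1 + u i2 + u i3 + v j1 + v j2 + v j3))).
by rewrite -!min3D; congr (min3 _ _ _ = min3 _ _ _); ring.
Qed.

(* The fifth hypothesis is the condition on 3x3 minors of columns 0, a, b. *)
Lemma min_exchange (a b : I -> F) :
    (forall i, 0 <= a i) -> (forall i, 0 <= b i) ->
    (exists p, a p = 0) -> (exists q, b q = 0) ->
    (forall i k r, min3 (a k + b r) (a i + b k) (b i + a r) =
                   min3 (b k + a r) (a i + b r) (b i + a k)) ->
    (exists i, 0 < a i /\ 0 < b i) ->
  forall i k, Num.min (a k) (b i) = Num.min (b k) (a i).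
Proof.
move=> a0 b0 [p ap] [q bq] H [s [as0 bs0]].
(* Without a common zero, rows [s], [p], [q] would give minimum 0 on the left and a positive one on
   the right. *)
have [z [az bz]] : exists z, a z = 0 /\ b z = 0.
  have [bp|bp] := eqVneq (b p) 0; first by exists p.
  have [aq|aq] := eqVneq (a q) 0; first by exists q.
  have {}bp : 0 < b p by rewrite lt0r bp b0.
  have {}aq : 0 < a q by rewrite lt0r aq a0.
  have := H s p q; rewrite ap bq !add0r !addr0.
  have [m1 _ _ _] := min3P 0 (a s + b p) (b s + a q).
  have [_ _ _ m2] := min3P (b p + a q) (a s) (b s).
  by move=> E; exfalso; move: m1 m2; rewrite E => ? []; lra.
have {}H i k : min3 (a i + b k) (b i) (a k) = min3 (b i + a k) (b k) (a i).
  by have := H z i k; rewrite az bz !add0r.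
(* Against row [s], where both columns are positive, a zero of one column forces a zero of the
   other. *)
have supp k : (a k == 0) = (b k == 0).
  apply/eqP/eqP => k0; have := H s k; rewrite k0 ?add0r ?addr0.
  - have [_ _ m1 _] := min3P (a s + b k) (b s) 0.
    have [_ _ _ m2] := min3P (b s) (b k) (a s).
    by have := b0 k; move=> ? E; move: m1 m2; rewrite E => ? []; lra.
  - have [_ _ _ m1] := min3P (a s) (b s) (a k).
    have [_ m2 _ _] := min3P (b s + a k) 0 (a s).
    by have := a0 k; move=> ? E; move: m2 m1; rewrite -E => ? []; lra.
move=> i k; have [ak|ak] := eqVneq (a k) 0.
  have /eqP bk : b k == 0 by rewrite -supp ak.
  by rewrite ak bk !min_l.
have [bi|bi] := eqVneq (b i) 0.
  have /eqP ai : a i == 0 by rewrite supp bi.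
  by rewrite ai bi !min_r.
have ak0 : 0 < a k by rewrite lt0r ak a0.
have bi0 : 0 < b i by rewrite lt0r bi b0.
have ai0 : 0 < a i by rewrite lt0r supp bi a0.
have bk0 : 0 < b k by rewrite lt0r -supp ak b0.
(* All four entries being positive, each sum exceeds both single entries on the opposite side, so it
   never attains the minimum. *)
have := H i k; rewrite /min3.
by case: (leP (a k) (b i)) => ?; case: (leP (b k) (a i)) => ?;
  case: leP => ?; case: leP => ? *; lra.
Qed.

(** This is the exchange relation at [k = q]. It is applied with [q] a row where [b] is maximal. *)
Lemma truncation (a b : I -> F) q :
    (forall i k, Num.min (a k) (b i) = Num.min (b k) (a i)) ->
    (forall i, a i <= b q) ->
  forall i, a i = Num.min (b i) (a q).
Proof. by move=> H ab i; rewrite minC H min_r. Qed.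

Definition trop_rank_le2 (A : I -> J -> F) := exists b1 b2 c1 c2,
  forall i j, A i j = Num.min (b1 i + c1 j) (b2 i + c2 j).

Lemma minors3_vanish_rank_le2 (A : I -> J -> F) (i0 : I) (j0 : J) :
  minors3_vanish A -> trop_rank_le2 A.
Proof.
move=> PA.
(* Row and column shifts make column [j0] zero and every column nonnegative with minimum 0. *)
pose am j := [arg min_(i < i0) (A i j - A i j0)]%O.
pose v j := A (am j) j - A (am j) j0.
have vmin i j : v j <= A i j - A i j0.
  rewrite /v /am; case: arg_minP => //= k _; exact.
pose a i j := A i j + - A i j0 + - v j.
have Pa : minors3_vanish a := minors3_vanish_shift _ _ PA.
have a_ge0 i j : 0 <= a i j by rewrite subr_ge0.
have a_0 j : exists p, a p j = 0 by exists (am j); rewrite /a subrr.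
have aj0 i : a i j0 = 0 by rewrite /a /v !subrr.
have exch j l : (exists i, 0 < a i j /\ 0 < a i l) ->
    forall i k, Num.min (a k j) (a i l) = Num.min (a k l) (a i j).
  apply: min_exchange => // i k r.
  by have := Pa i k r j0 j l; rewrite !aj0 !add0r !addr0.
pose pk j := [arg max_(i > i0) a i j]%O.
have pkP i j : a i j <= a (pk j) j.
  by rewrite /pk; case: arg_maxP => //= k _; exact.
(* The ends of the tropical segment: the column with the largest entry, and the
   one with the largest entry among those with support disjoint from it. *)
pose p := [arg max_(j > j0) a (pk j) j]%O.
have pP j : a (pk j) j <= a (pk p) p.
  by rewrite /p; case: arg_maxP => //= k _; exact.
pose dis j := [forall i, (a i j == 0) || (a i p == 0)].
pose q := [arg max_(j > j0 | dis j) a (pk j) j]%O.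
(* The zero column [j0] satisfies [dis], so the restricted maximum is attained. *)
have [qdis qP] : dis q /\ forall j, dis j -> a (pk j) j <= a (pk q) q.
  rewrite /q; case: arg_maxP => //=; by apply/forallP => i; rewrite aj0 eqxx.
have trunc j l : (exists i, 0 < a i j /\ 0 < a i l) ->
    a (pk j) j <= a (pk l) l -> forall i, a i j = Num.min (a i l) (a (pk l) j).
  move=> jl jlP; apply: truncation; first exact: exch.
  by move=> i; apply: le_trans jlP.
clearbody q p pk.
(* Column [j] is a truncation of column [q] if [dis j], of column [p] otherwise. The truncation
   height can be added to the other column because [a i p] or [a i q] vanishes in every row. *)
pose c1 j := if dis j then a (pk q) j else 0.
pose c2 j := if dis j then 0 else a (pk p) j.
have key i j : a i j = Num.min (a i p + c1 j) (a i q + c2 j).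
  have /orP pq0 := forallP qdis i.
  have [p0 q0] := (a_ge0 i p, a_ge0 i q).
  rewrite /c1 /c2; case: ifPn => [dj|].
    have [[k jq]|jq] := pselect (exists i, 0 < a i j /\ 0 < a i q).
      rewrite (trunc j q) ?qP //; last by exists k.
      case: pq0 => /eqP->; last by rewrite add0r addr0 minC.
      by rewrite addr0 (min_l (a_ge0 _ _)) min_r // addr_ge0.
    (* Otherwise the minor on columns [p], [q], [j] and their peak rows is positive on the diagonal
       and 0 elsewhere: its even minimum is 0, while every odd term contains a diagonal entry. *)
    have j_eq0 : forall i, a i j = 0.
      move=> s; apply/eqP; apply: contra_notT jq => sj.
      have jj : 0 < a (pk j) j.
        by rewrite (lt_le_trans _ (pkP s j)) // lt0r sj a_ge0.
      have qq : 0 < a (pk q) q := lt_le_trans jj (qP _ dj).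
      have pp : 0 < a (pk p) p := lt_le_trans qq (pP q).
      have zero k l x : (a k l == 0) || (a k x == 0) -> 0 < a k x -> a k l = 0.
        by case/orP => /eqP -> //; rewrite ltxx.
      have pj : a (pk j) p = 0.
        by apply: (zero _ _ j) jj; rewrite orbC; apply: (forallP dj).
      have pq : a (pk q) p = 0.
        by apply: (zero _ _ q) qq; rewrite orbC; apply: (forallP qdis).
      have jp : a (pk p) j = 0 by apply: (zero _ _ p) pp; apply: (forallP dj).
      have qp : a (pk p) q = 0 by apply: (zero _ _ p) pp; apply: (forallP qdis).
      have [qj|qj] := eqVneq (a (pk j) q) 0; last first.
        by exists (pk j); rewrite jj lt0r qj a_ge0.
      have [jq|jq] := eqVneq (a (pk q) j) 0; last first.
        by exists (pk q); rewrite qq lt0r jq a_ge0.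
      have := Pa (pk p) (pk q) (pk j) p q j.
      rewrite pj pq jp qp qj jq !addr0 !add0r => E; exfalso.
      have [_ m1 _ _] := min3P (a (pk p) p + a (pk q) q + a (pk j) j) 0 0.
      have [_ _ _ m2] := min3P (a (pk p) p) (a (pk j) j) (a (pk q) q).
      by move: m1 m2; rewrite E => ? []; lra.
    rewrite !j_eq0 !addr0.
    by case: pq0 => /eqP ->; [rewrite min_r | rewrite min_l].
  rewrite negb_forall => /existsP[k]; rewrite negb_or => /andP[akj akp].
  have jp : exists i, 0 < a i j /\ 0 < a i p.
    by exists k; rewrite !lt0r akj akp !a_ge0.
  rewrite (trunc j p) // addr0.
  case: pq0 => /eqP->; rewrite ?add0r //.
  by have := a_ge0 (pk p) j; rewrite !min_l // ler_wpDl.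
exists (fun i => A i j0 + a i p), (fun i => A i j0 + a i q),
  (fun j => v j + c1 j), (fun j => v j + c2 j) => i j.
rewrite (addrACA _ (a i p)) (addrACA _ (a i q)) -addr_minr -key /a; ring.
Qed.
End TropicalRankTwo.

(** * Symmetric factorization of tropical matrices *)

Section SymmetricFactorization.
Variables (F : realFieldType) (I : finType).

(* The entries of S (.) Q (.) S^T, for S with columns s1, s2 and
   Q = [a b; b c]. *)
Definition sym_trop (s1 s2 : I -> F) (a b c : F) (i j : I) : F :=
  Num.min (Num.min (s1 i + a + s1 j) (s1 i + b + s2 j))
          (Num.min (s2 i + b + s1 j) (s2 i + c + s2 j)).

(** The difference [c2 j - c1 j] locates column [j] on the tropical segment, with ends [p] and [q].
    Column [p], shifted, reproduces the [b1] term and column [q] the [b2] term; the remaining term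
    of each is dominated. *)
Lemma trop_rank_le2_columns (A : I -> I -> F) (i0 : I) : trop_rank_le2 A ->
  exists p q al be, forall i j, A i j = Num.min (A i p + al j) (A i q + be j).
Proof.
move=> [b1 [b2 [c1 [c2 AE]]]].
pose f j := c2 j - c1 j.
pose p := [arg max_(j > i0) f j]%O.
pose q := [arg min_(j < i0) f j]%O.
have pP j : f j <= f p by rewrite /p; case: arg_maxP => //= k _; exact.
have qP j : f q <= f j by rewrite /q; case: arg_minP => //= k _; exact.
clearbody p q.
exists p, q, (fun j => c1 j - c1 p), (fun j => c2 j - c2 q) => i j.
have := pP j; have := qP j; rewrite /f !AE !addr_minl => ? ?.
rewrite (_ : b1 i + c1 p + _ = b1 i + c1 j); last by ring.
rewrite (_ : b2 i + c2 q + _ = b2 i + c2 j); last by ring.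
have xw : b1 i + c1 j <= b1 i + c1 q + (c2 j - c2 q) by lra.
have yu : b2 i + c2 j <= b2 i + c2 p + (c1 j - c1 p) by lra.
case: (leP (b1 i + c1 j) (b2 i + c2 j)) => [xy|/ltW yx].
  by rewrite (min_l (le_trans xy yu)) min_l // le_min xw.
by rewrite (min_r (le_trans yx xw)) min_r // le_min yx.
Qed.

(** The column expansion is used twice, the second time on [A i p = A p i] and [A i q = A q i]. *)
Lemma sym_trop_rank_le2 (A : I -> I -> F) (i0 : I) :
    (forall i j, A i j = A j i) -> trop_rank_le2 A ->
  exists s1 s2 a b c, forall i j, A i j = sym_trop s1 s2 a b c i j.
Proof.
move=> As /(trop_rank_le2_columns i0)[p [q [al [be AE]]]].
exists al, be, (A p p), (A p q), (A q q) => i j.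
rewrite {1}AE (As i p) (As i q) (AE p i) (AE q i) (As q p) !addr_minl.
rewrite minACA /sym_trop.
by congr (Num.min (Num.min _ _) (Num.min _ _)); ring.
Qed.

End SymmetricFactorization.

(** * Puiseux matrices of rank at most 2: minors and monomial lifts *)

Section PuiseuxRankTwo.
Variable n : nat.

(** Separating even from odd terms leaves only sums, so leading terms can be compared. Factoring [M]
    through its rank reduces the claim to a polynomial identity. *)
Lemma rank_le2_minors3 (K : fieldType) (M : 'M[K]_n) : (\rank M <= 2)%N ->
  forall i1 i2 i3 j1 j2 j3,
  M i1 j1 * M i2 j2 * M i3 j3 +
    (M i1 j2 * M i2 j3 * M i3 j1 + M i1 j3 * M i2 j1 * M i3 j2) =
  M i1 j1 * M i2 j3 * M i3 j2 +
    (M i1 j2 * M i2 j1 * M i3 j3 + M i1 j3 * M i2 j2 * M i3 j1).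
Proof.
move=> rM i1 i2 i3 j1 j2 j3; rewrite -(mulmx_base M).
move: (col_base M) (row_base M) rM; move: (\rank M) => [|[|[|//]]] B C _.
all: rewrite !mxE ?big_ord0 ?big_ord_recl ?big_ord0; ring.
Qed.

Lemma rank_le2_pval (K : numFieldType) (M : 'M[puiseux K]_n) :
    (\rank M <= 2)%N -> (forall i j, ppos (M i j)) ->
  minors3_vanish (fun i j => pval (M i j)).
Proof.
move=> rM Mpos i1 i2 i3 j1 j2 j3.
have Mp i j := ppos_at (Mpos i j).
have pos3 i j k l r s := pos_atM (pos_atM (Mp i j) (Mp k l)) (Mp r s).
have pos_sum a b c f g h := fun fP gP hP =>
  @pos_atD K a _ f _ fP (@pos_atD K b c g h gP hP).
apply: pos_at_inj; first exact: pos_sum (pos3 _ _ _ _ _ _) (pos3 _ _ _ _ _ _)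
  (pos3 _ _ _ _ _ _).
rewrite (rank_le2_minors3 rM).
exact: pos_sum (pos3 _ _ _ _ _ _) (pos3 _ _ _ _ _ _) (pos3 _ _ _ _ _ _).
Qed.

Lemma pmonD (K : numFieldType) q r : pmon K (q + r) = pmon K q * pmon K r.
Proof.
apply: puiseux_eq => s; rewrite pcoefM (@fsum_seq _ _ [:: q]) // => [|a].
  rewrite big_seq1 /= /pmon_fun eqxx mul1r; congr (_%:R).
  by rewrite subr_eq addrC.
by rewrite inE /= /pmon_fun => /negPf->; rewrite mul0r.
Qed.

(** This is [sym_trop] with sums for minima and monomials for tropical products. *)
Definition sym_lift (K : numFieldType) (s1 s2 : 'I_n -> rat) (a b c : rat) i j
    : puiseux K :=
  (pmon K (s1 i + a + s1 j) + pmon K (s1 i + b + s2 j)) +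
  (pmon K (s2 i + b + s1 j) + pmon K (s2 i + c + s2 j)).

Lemma sym_liftC (K : numFieldType) s1 s2 a b c i j :
  sym_lift K s1 s2 a b c i j = sym_lift K s1 s2 a b c j i.
Proof. by rewrite /sym_lift !pmonD; ring. Qed.

Lemma sym_lift_pos_at (K : numFieldType) s1 s2 a b c i j :
  pos_at (sym_trop s1 s2 a b c i j) (sym_lift K s1 s2 a b c i j).
Proof. by do 2!apply: pos_atD; exact: pos_at_pmon. Qed.

Lemma rank_sym_lift (K : numFieldType) s1 s2 a b c :
  (\rank (\matrix_(i, j) sym_lift K s1 s2 a b c i j) <= 2)%N.
Proof.
(* [u], [w] are the columns of the lifted S; [u'], [w'] are the rows of the lifted Q S^T. *)
pose u : 'cV[puiseux K]_n := \col_i pmon K (s1 i).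
pose w : 'cV[puiseux K]_n := \col_i pmon K (s2 i).
pose u' : 'rV[puiseux K]_n := \row_j (pmon K (a + s1 j) + pmon K (b + s2 j)).
pose w' : 'rV[puiseux K]_n := \row_j (pmon K (b + s1 j) + pmon K (c + s2 j)).
rewrite (_ : \matrix_(i, j) _ = row_mx u w *m col_mx u' w').
  by rewrite (leq_trans (mxrankM_maxl _ _)) // rank_leq_col.
apply/matrixP => i j; rewrite mul_row_col !mxE !big_ord1 !mxE /sym_lift !pmonD.
ring.
Qed.

(** Monomials have coefficients 0 and 1, which [phi] preserves. *)
Lemma map_sym_lift (K L : numFieldType) (phi : {rmorphism K -> L}) s1 s2 a b c
    i j :
  map_puiseux phi (sym_lift K s1 s2 a b c i j) = sym_lift L s1 s2 a b c i j.
Proof.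
by apply: puiseux_eq => q; rewrite /= !rmorphD /= /pmon_fun !rmorph_nat.
Qed.

Lemma uindexC (i j : 'I_n) : uindex i j = uindex j i.
Proof.
congr enum_rank; apply: val_inj => /=; rewrite /usort.
by case: ltngtP => // /val_inj ->.
Qed.

Lemma tr_symmx (T : Type) (x : 'rV[T]_#|{: utri n}|) : (symmx x)^T = symmx x.
Proof. by apply/matrixP => i j; rewrite !mxE uindexC. Qed.

Definition upper_row (T : Type) (G : 'I_n -> 'I_n -> T)
    : 'rV[T]_#|{: utri n}| :=
  \row_k G (val (enum_val k)).1 (val (enum_val k)).2.

Lemma symmx_upper_row (T : Type) (G : 'I_n -> 'I_n -> T) :
  (forall i j, G i j = G j i) -> symmx (upper_row G) = \matrix_(i, j) G i j.
Proof.
move=> GC; apply/matrixP => i j; rewrite !mxE enum_rankK /= /usort.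
by case: leqP.
Qed.

End PuiseuxRankTwo.

(** * Barvinok rank at most 2 *)

Section BarvinokRankTwo.
Variables (R : realType) (n : nat).

Lemma barvinok_rank_le2P (A : 'M[R]_n) :
  (barvinok_rank A <= 2)%N <-> trop_rank_le2 (fun i j => A i j).
Proof.
rewrite /barvinok_rank; case: ex_minnP => r /asboolP[B [C ABC]] rmin.
have AE i j : (A i j)%:E = \big[Order.min/+oo%E]_(k < r) (B i k + C k j)%:E.
  by move/matrixP/(_ i j): ABC; rewrite !mxE.
split=> [|[b1 [b2 [c1 [c2 bE]]]]]; last first.
  apply: rmin; apply/asboolP.
  exists (\matrix_(i < n, k < 2) if k == 0 then b1 i else b2 i),
    (\matrix_(k < 2, j < n) if k == 0 then c1 j else c2 j).
  apply/matrixP => i j; rewrite !mxE !big_ord_recl big_ord0 !mxE /= bE.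
  by rewrite (min_l (leey _)) EFin_min.
case: r B C AE {ABC rmin} => [|[|[|//]]] B C AE _.
(* For [r = 0] the product has entries +oo, which no entry of [A] equals; for [r = 1] the single
   term is repeated. *)
- exists (fun=> 0), (fun=> 0), (fun=> 0), (fun=> 0) => i j.
  by have := AE i j; rewrite big_ord0.
- exists (fun i => B i 0), (fun i => B i 0), (fun j => C 0 j), (fun j => C 0 j).
  move=> i j; have := AE i j; rewrite big_ord_recl big_ord0 (min_l (leey _)).
  by rewrite minxx => -[].
- exists (fun i => B i 0), (fun i => B i 1), (fun j => C 0 j), (fun j => C 1 j).
  move=> i j; have := AE i j; rewrite !big_ord_recl big_ord0 (min_l (leey _)).
  rewrite -EFin_min => -[->].
  by congr (Num.min _ (B _ _ + C _ _)); apply: val_inj.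
Qed.

End BarvinokRankTwo.

(** * Closures and rational approximation *)

Section Tropicalizations.
Variables (R : realType) (n : nat).

Lemma trop_Rpos_sub : trop_Rpos (S2 R n) `<=` trop_Cpos (S2 R n).
Proof.
apply: closureS => _ [x [Sx xpos] <-].
have phi0 : {homo real_complex R : a / 0 < a} by move=> a; rewrite ltcR.
have xat k : pos_at (pval (x 0 k)) (map_puiseux (real_complex R) (x 0 k)).
  exact/map_puiseux_pos_at/ppos_at/xpos.
exists (map_mx (map_puiseux (real_complex R)) x).
  by split=> // k; rewrite mxE; have [] := pos_at_val (xat k).
by apply/rowP => k; rewrite !mxE; have [_ ->] := pos_at_val (xat k).
Qed.

Lemma min3_ratr (x y z : rat) :
  min3 (ratr x) (ratr y) (ratr z) = ratr (min3 x y z) :> R.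
Proof. by rewrite /min3 !minr_rat. Qed.

(** For fixed indices the condition is the vanishing of a continuous function, the difference [g] of
    the two minima. *)
Lemma closed_minors3_vanish :
  closed [set x : 'rV[R]_#|{: utri n}| |
    minors3_vanish (fun i j => symmx x i j)].
Proof.
have entry_continuous i j :
    continuous (fun x : 'rV[R]_#|{: utri n}| => symmx x i j : R^o).
  rewrite (_ : (fun x => _) = fun x : 'rV[R]_#|{: utri n}| => x 0 (uindex i j)).
    exact: coord_continuous.
  by apply/funext => x; rewrite mxE.
move=> x clx i1 i2 i3 j1 j2 j3; apply/eqP; rewrite -subr_eq0; apply/eqP.
set h := fun y : 'rV[R]_#|{: utri n}| => fun i j => symmx y i j.
pose g y : R^o := min3 (h y i1 j1 + h y i2 j2 + h y i3 j3)
    (h y i1 j2 + h y i2 j3 + h y i3 j1) (h y i1 j3 + h y i2 j1 + h y i3 j2) -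
  min3 (h y i1 j1 + h y i2 j3 + h y i3 j2)
    (h y i1 j2 + h y i2 j1 + h y i3 j3) (h y i1 j3 + h y i2 j2 + h y i3 j1).
have g_continuous : continuous g.
  have cD3 a b c d e f :
      continuous (fun y => h y a b + h y c d + h y e f : R^o).
    move=> y; exact: (cvgD (cvgD (entry_continuous a b y)
      (entry_continuous c d y)) (entry_continuous e f y)).
  have c_min3 (f1 f2 f3 : 'rV[R]_#|{: utri n}| -> R^o) : continuous f1 ->
      continuous f2 -> continuous f3 ->
      continuous (fun y => min3 (f1 y) (f2 y) (f3 y) : R^o).
    move=> c1 c2 c3 y.
    exact: (@continuous_min R _ f1 (f2 \min f3) y (c1 y)
      (continuous_min (c2 y) (c3 y))).
  have cmin3 a1 a2 a3 a4 a5 a6 b1 b2 b3 b4 b5 b6 c1 c2 c3 c4 c5 c6 :=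
    c_min3 _ _ _ (cD3 a1 a2 a3 a4 a5 a6) (cD3 b1 b2 b3 b4 b5 b6)
      (cD3 c1 c2 c3 c4 c5 c6).
  move=> y; exact: (cvgB (cmin3 _ _ _ _ _ _ _ _ _ _ _ _ _ _ _ _ _ _ y)
    (cmin3 _ _ _ _ _ _ _ _ _ _ _ _ _ _ _ _ _ _ y)).
have gcl : closed [set y | g y = 0].
  exact: ((continuous_closedP _).1 g_continuous _ (@closed_eq R 0)).
by apply: gcl; move: x clx; apply: closureS => y yP /=; rewrite /g yP subrr.
Qed.

(** The identity holds for the rational valuations, is carried to [R] by [ratr], and passes to the
    closure. *)
Lemma trop_Cpos_minors3 x : trop_Cpos (S2 R n) x ->
  minors3_vanish (fun i j => symmx x i j).
Proof.
move=> Tx; apply: closed_minors3_vanish => B /Tx [_ [[y [Sy ypos] <-] By]].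
exists (Defs.tval R y); split => //= i1 i2 i3 j1 j2 j3.
have ypos' i j : ppos (symmx y i j) by rewrite mxE.
have := rank_le2_pval Sy ypos' i1 i2 i3 j1 j2 j3.
move=> /(congr1 (@ratr R)); rewrite -!min3_ratr !rmorphD /=.
by rewrite /symmx !mxE.
Qed.

Lemma ratr_approx (x e : R) : 0 < e -> exists q : rat, `|x - ratr q| < e.
Proof.
move=> e0; have [|q] := @rat_in_itvoo R (x - e) (x + e); first by lra.
by rewrite in_itv /= => /andP[h1 h2]; exists q; rewrite ltr_norml; lra.
Qed.

Lemma min_close (a b c d e : R) : `|a - c| < e -> `|b - d| < e ->
  `|Num.min a b - Num.min c d| < e.
Proof.
rewrite !ltr_norml => /andP[? ?] /andP[? ?].
by case: (leP a b) => ?; case: (leP c d) => ?; apply/andP; lra.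
Qed.

Lemma sum3_close (a b c a' b' c' e : R) :
  `|a - a'| < e / 3 -> `|b - b'| < e / 3 -> `|c - c'| < e / 3 ->
  `|a + b + c - (a' + b' + c')| < e.
Proof.
by rewrite !ltr_norml => /andP[? ?] /andP[? ?] /andP[? ?]; apply/andP; lra.
Qed.

Lemma ratr_sym_trop (s1 s2 : 'I_n -> rat) a b c i j :
  ratr (sym_trop s1 s2 a b c i j) =
  sym_trop (ratr \o s1) (ratr \o s2) (ratr a) (ratr b) (ratr c) i j :> R.
Proof. by rewrite /sym_trop !minr_rat !rmorphD. Qed.

(** Exponents must be rational, so the parameters are approximated within [e / 3]: each entry is a
    minimum of sums of three of them, and minima do not enlarge errors. *)
Lemma sym_trop_Rpos s1 s2 (a b c : R) (x : 'rV[R]_#|{: utri n}|) :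
    (forall i j, symmx x i j = sym_trop s1 s2 a b c i j) ->
  trop_Rpos (S2 R n) x.
Proof.
move=> xE B /nbhs_ballP[e /= e0 eB].
have e30 : 0 < e / 3 by rewrite divr_gt0.
have [s1' s1P] := choice (fun i => ratr_approx (s1 i) e30).
have [s2' s2P] := choice (fun i => ratr_approx (s2 i) e30).
have [[[a' aP] [b' bP]] [c' cP]] :=
  (ratr_approx a e30, ratr_approx b e30, ratr_approx c e30).
pose y K := upper_row (sym_lift K s1' s2' a' b' c').
exists (Defs.tval R (y R)); split.
  exists (y R) => //; split=> [|k]; last first.
    by rewrite mxE; have [] := pos_at_val (sym_lift_pos_at R s1' s2' a' b' c'
      (val (enum_val k)).1 (val (enum_val k)).2).
  rewrite (_ : map_mx _ _ = y R[i]); last first.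
    by apply/rowP => k; rewrite !mxE map_sym_lift.
  rewrite /S2 /sym_rank_le2 /= symmx_upper_row; last exact: sym_liftC.
  exact: rank_sym_lift.
apply: eB; split=> // i k; rewrite (ord1 i) -ball_normE /= !mxE.
set i1 := (val (enum_val k)).1; set i2 := (val (enum_val k)).2.
have [_ ->] := pos_at_val (sym_lift_pos_at R s1' s2' a' b' c' i1 i2).
(* [uindex] sorts its pair of indices, and the pair behind [enum_val k] is already sorted. *)
have -> : x 0 k = symmx x i1 i2.
  rewrite mxE; congr (x 0 _); apply: enum_val_inj; rewrite enum_rankK.
  apply: val_inj => /=; rewrite /usort ifT -?surjective_pairing //.
  exact: (valP (enum_val k)).
rewrite xE ratr_sym_trop /sym_trop.
by do 2![apply: min_close]; apply: sum3_close => /=.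
Qed.

End Tropicalizations.

Theorem theorem3p5 (R : realType) (n : nat) :
  [set symmx x | x in trop_Cpos (S2 R n)] =
    [set symmx x | x in trop_Rpos (S2 R n)] /\
  [set symmx x | x in trop_Rpos (S2 R n)] =
    [set A : 'M[R]_n | A = A^T /\ (barvinok_rank A <= 2)%N].
Proof.
have RC : [set symmx x | x in trop_Rpos (S2 R n)] `<=`
    [set symmx x | x in trop_Cpos (S2 R n)].
  exact/image_subset/trop_Rpos_sub.
have CB : [set symmx x | x in trop_Cpos (S2 R n)] `<=`
    [set A : 'M[R]_n | A = A^T /\ (barvinok_rank A <= 2)%N].
  move=> _ [x Tx <-]; split; first by rewrite tr_symmx.
  (* For [n = 0] there is no base row or column [ord0], but any witnesses do. *)
  apply/barvinok_rank_le2P; case: n {RC} x Tx => [|m] x Tx.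
    by exists (fun=> 0), (fun=> 0), (fun=> 0), (fun=> 0) => -[].
  exact/(minors3_vanish_rank_le2 ord0 ord0)/trop_Cpos_minors3.
have BR : [set A : 'M[R]_n | A = A^T /\ (barvinok_rank A <= 2)%N] `<=`
    [set symmx x | x in trop_Rpos (S2 R n)].
  move=> A [AT /barvinok_rank_le2P rA].
  have As i j : A i j = A j i by rewrite {1}AT mxE.
  have AE : symmx (upper_row (fun i j => A i j)) = A.
    by rewrite symmx_upper_row //; apply/matrixP => i j; rewrite mxE.
  exists (upper_row (fun i j => A i j)) => //.
  have [s1 [s2 [a [b [c sE]]]]] : exists s1 s2 a b c,
      forall i j, A i j = sym_trop s1 s2 a b c i j.
    case: n {RC CB AT AE} A As rA => [|m] A As rA; last first.
      exact: (sym_trop_rank_le2 ord0).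
    by exists (fun=> 0), (fun=> 0), 0, 0, 0 => -[].
  by apply: (@sym_trop_Rpos _ _ s1 s2 a b c) => i j; rewrite AE.
split; apply/seteqP; split=> //; first exact: subset_trans CB BR.
exact: subset_trans RC CB.
Qed.
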